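(* Let $n\geq 6$ be an integer, and regard $\tilde{J}(n,3)$ as a subset of the $(n-1)$-dimensional Euclidean space $H_{n,3}=\{(x_1,\dots,x_n)\in\mathbb{R}^n:\sum_i x_i=3\}\simeq\mathbb{R}^{n-1}$. (1) If $n\neq 8,9$, then $\tilde{J}(n,3)$ is maximal as a three-distance set in $H_{n,3}$. (2) If $n=8$, then the maximal three-distance set in $H_{8,3}$ which contains $\tilde{J}(8,3)$ is (uniquely) $$\tilde{J}(8,3)\ \cup\ \left(\left(\tfrac12\right)^7,\,-\tfrac12\right)^P,$$ which has $64$ vectors. (3) If $n=9$, let $x_0=\left(\left(\tfrac13\right)^9\right)$ and $Y=\left(\tfrac43,\,\left(\tfrac13\right)^7,\,-\tfrac23\right)^P$. The map $y\mapsto 2x_0-y$ partitions $Y$ into pairs $\{y,2x_0-y\}$. The maximal three-distance sets in $H_{9,3}$ which contain $\tilde{J}(9,3)$ are exactly the sets $$\tilde{J}(9,3)\cup\{x_0\}\cup Y',$$ where $Y'\subset Y$ contains exactly one vector from each pair $\{y,2x_0-y\}$. Each of these sets has $121$ vectors.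
   Context: Notation: $(a_1^{r_1},\dots,a_t^{r_t})^P$ denotes the set of all vectors obtained by permuting the coordinates of the vector in which $a_i$ occurs $r_i$ times; inside the parentheses exponents are multiplicities, not powers. $((a)^n)$ is the constant vector $(a,\dots,a)\in\mathbb{R}^n$. $\tilde{J}(n,3)=(1^3,0^{n-3})^P\subset\mathbb{R}^n$ is the set of all $0/1$ vectors of length $n$ with exactly three ones (the representation of the Johnson graph $J(n,3)$). A finite subset of a Euclidean space is an $s$-distance set if exactly $s$ distinct values occur as Euclidean distances between distinct points of it. An $s$-distance set is maximal in a given space if no other $s$-distance set in that space contains it. *)

(* Defs.v *)
From HB Require Import structures.
From mathcomp Require Import all_boot all_order all_algebra.
From mathcomp Require Import boolp classical_sets functions cardinality reals.
Set Implicit Arguments.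
Unset Strict Implicit.
Unset Printing Implicit Defensive.
Import Order.TTheory GRing.Theory Num.Theory.
Local Open Scope classical_set_scope.
Local Open Scope ring_scope.

(* The norm that the libraries put on 'rV[R]_n is the sup norm, hence an
   explicit Euclidean distance. *)
Definition euclidean_dist (R : realType) (n : nat) (x y : 'rV[R]_n) : R :=
  Num.sqrt (\sum_(i < n) (x 0 i - y 0 i) ^+ 2).

Definition distances (R : realType) (n : nat) (A : set 'rV[R]_n) : set R :=
  [set d | exists x y : 'rV[R]_n,
     [/\ A x, A y, x <> y & d = euclidean_dist x y]].

Definition s_distance_set (R : realType) (n s : nat) (A : set 'rV[R]_n) : Prop :=
  finite_set A /\ (distances A #= `I_s)%card.

Definition maximal_s_distance_set (R : realType) (n s : nat)
    (H A : set 'rV[R]_n) : Prop :=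
  [/\ A `<=` H, s_distance_set s A &
      forall B : set 'rV[R]_n,
        B `<=` H -> s_distance_set s B -> A `<=` B -> B = A].

(* (a_1^{r_1}, ..., a_t^{r_t})^P, exponents being multiplicities, is
   [permvecs n [:: (a_1, r_1); ...; (a_t, r_t)]]; it is meant to be used with
   r_1 + ... + r_t = n, and is empty otherwise. *)
Definition permvecs (R : realType) (n : nat) (s : seq (R * nat)) :
    set 'rV[R]_n :=
  [set x | perm_eq [seq x 0 i | i <- enum 'I_n]
                   (flatten [seq nseq ar.2 ar.1 | ar <- s])].
Arguments permvecs {R} n s.

Definition johnson (R : realType) (n k : nat) : set 'rV[R]_n :=
  permvecs n [:: (1, k); (0, (n - k)%N)].
Arguments johnson R n k : clear implicits.

Definition hyperplane (R : realType) (n k : nat) : set 'rV[R]_n :=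
  [set x | \sum_(i < n) x 0 i = k%:R].
Arguments hyperplane R n k : clear implicits.

Definition reflect_pt (R : realType) (n : nat) (c y : 'rV[R]_n) : 'rV[R]_n :=
  2 *: c - y.

Definition reflection_pairs (R : realType) (n : nat) (c : 'rV[R]_n)
    (Y : set 'rV[R]_n) : set (set 'rV[R]_n) :=
  [set [set y; reflect_pt c y] | y in Y].

Definition center9 (R : realType) : 'rV[R]_9 := const_mx (1 / 3).
Arguments center9 R : clear implicits.

Definition Y9 (R : realType) : set 'rV[R]_9 :=
  permvecs 9 [:: (4 / 3, 1%N); (1 / 3, 7%N); (- (2 / 3), 1%N)].
Arguments Y9 R : clear implicits.

Definition transversal9 (R : realType) (Y' : set 'rV[R]_9) : Prop :=
  Y' `<=` Y9 R /\
  forall p, reflection_pairs (center9 R) (Y9 R) p -> exists! y, p y /\ Y' y.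

Definition extension9 (R : realType) (Y' : set 'rV[R]_9) : set 'rV[R]_9 :=
  johnson R 9 3 `|` [set center9 R] `|` Y'.

(* Main.v *)
(* Write x as a point of H at squared distance 2, 4 or 6 from every vector of
   J = J~(n,3), x not in J.  Since |x - 1_S|^2 = |x|^2 + 3 - 2 x(S), the sums
   x(S) over 3-subsets S differ pairwise by at most 2, and by integers.  As
   n >= 6, comparing disjoint 3-subsets forces all but at most two coordinates
   of x to be equal to some t, the exceptional two being t + a and t + b with
   (a, b) in a list of eight shapes.  If Q is the squared distance to 1_S for S
   avoiding the exceptional coordinates, then n t = 3 - a - b gives
   n (a^2 + b^2 + 3 - Q) = (3 - a - b)^2, whose only solutions are the two
   vectors of the n = 9 case and the one of the n = 8 case.  For n = 9 the
   vectors of Y are x0 + e_i - e_j, that is the roots of A_8 translated by x0,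
   and two of them are at a squared distance other than 2, 4, 6 exactly when
   they are opposite. *)
Require Import Defs.
From HB Require Import structures.
From mathcomp Require Import all_boot all_order all_algebra finmap.
From mathcomp Require Import boolp classical_sets functions cardinality reals.
From mathcomp Require Import ring lra.
Set Implicit Arguments.
Unset Strict Implicit.
Unset Printing Implicit Defensive.
Import Order.TTheory GRing.Theory Num.Theory.
Local Open Scope classical_set_scope.
Local Open Scope ring_scope.

(** * Vectors with few distinct coordinates, and their squared distances *)

Lemma perm_eq_enum_setC (T : finType) (S : {set T}) :
  perm_eq (enum T) (enum S ++ enum (~: S)).
Proof.
have /permPl := perm_filterC (mem S) (enum T); rewrite perm_sym.
suff -> : enum (~: S) = [seq x <- enum T | predC (mem S) x] by rewrite enumT.
by rewrite enumT; apply: eq_filter => i; rewrite /= !inE.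
Qed.

Lemma map_enum_const (T : finType) (U : eqType) (f : T -> U) (S : {set T}) c :
  (forall i, i \in S -> f i = c) -> [seq f i | i <- enum S] = nseq #|S| c.
Proof.
move=> fS; rewrite cardE -(size_map f).
by apply/all_pred1P/allP => y /mapP[i]; rewrite mem_enum => /fS ? ->; apply/eqP.
Qed.

Section Vectors.
Variables (R : realType) (n : nat).
Implicit Types (S : {set 'I_n}) (i j k : 'I_n) (x y : 'rV[R]_n).

Definition two_valued (a b : R) S : 'rV[R]_n :=
  \row_i (if i \in S then a else b).

Definition indic S : 'rV[R]_n := two_valued 1 0 S.

(** As a and b differ, S is recovered as the level set of a, and counting the occurrences of a gives
    its size. *)
Lemma permvecs_two_valued a b m p x : a != b -> (m + p = n)%N ->
  permvecs n [:: (a, m); (b, p)] x <->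
  exists2 S : {set 'I_n}, #|S| = m & x = two_valued a b S.
Proof.
move=> ab mpn; rewrite /permvecs /= cats0; split.
  move=> /permP px; exists [set i | x 0 i == a]%SET.
    have := px (pred1 a).
    rewrite count_map count_cat !count_nseq /= eqxx eq_sym (negbTE ab) mul1n mul0n addn0.
    rewrite -size_filter enumT => <-; rewrite cardE; congr size.
    by apply: eq_filter => i; rewrite /= inE.
  apply/rowP => i; rewrite mxE inE; case: eqP => // xa.
  have := perm_mem (introT permP px) (x 0 i).
  rewrite map_f ?mem_enum // mem_cat !mem_nseq; case/esym/orP => /andP[_ /eqP] //.
move=> [S Sm ->]; apply: (perm_trans (perm_map _ (perm_eq_enum_setC S))).
rewrite map_cat (map_enum_const (c := a)) ?(map_enum_const (c := b)).
- have : (#|S| + #|~: S| = n)%N by rewrite cardsC card_ord.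
  by rewrite Sm -[in RHS]mpn => /addnI ->.
- by move=> i; rewrite inE mxE => /negbTE ->.
- by move=> i; rewrite mxE => ->.
Qed.

Lemma johnsonE m x : (m <= n)%N ->
  johnson R n m x <-> exists2 S : {set 'I_n}, #|S| = m & x = indic S.
Proof. by move=> mn; apply: permvecs_two_valued; rewrite ?oner_neq0 ?subnKC. Qed.

(** This is t(1,...,1) + a e_i + b e_j. The case i = j is allowed, and then a and b add up; hence
    the [(i == j)%:R] terms in the distance formulas. *)
Definition bump (t a b : R) i j : 'rV[R]_n :=
  \row_k (t + a * (k == i)%:R + b * (k == j)%:R).

Definition sqdist x y : R := \sum_k (x 0 k - y 0 k) ^+ 2.

Lemma sqdistC x y : sqdist x y = sqdist y x.
Proof. by apply: eq_bigr => k _; rewrite -sqrrN opprB. Qed.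

Lemma sqdist_ge0 x y : 0 <= sqdist x y.
Proof. by apply: sumr_ge0 => k _; exact: sqr_ge0. Qed.

Lemma sum_mul_delta (F : 'I_n -> R) i : \sum_k F k * (k == i)%:R = F i.
Proof.
rewrite (bigD1 i) //= eqxx mulr1 big1 ?addr0 // => k /negbTE ->.
by rewrite mulr0.
Qed.

Lemma sqdist_bump t a b i j y :
  sqdist (bump t a b i j) y =
  \sum_k (t - y 0 k) ^+ 2 + (a ^+ 2 + 2 * a * (t - y 0 i))
    + (b ^+ 2 + 2 * b * (t - y 0 j)) + 2 * a * b * (i == j)%:R.
Proof.
pose c k := t - y 0 k.
(* Each isolated term is turned into a sum against a delta, so that the identity can be checked
   coordinate by coordinate. *)
rewrite -(sum_mul_delta (fun k => a ^+ 2 + 2 * a * c k)).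
rewrite -(sum_mul_delta (fun k => b ^+ 2 + 2 * b * c k)).
rewrite -(sum_mul_delta (fun k => 2 * a * b * (k == j)%:R)).
rewrite -!big_split; apply: eq_bigr => k _; rewrite mxE /c.
by case: (k == i); case: (k == j); rewrite /= ?mulr1n ?mulr0n; ring.
Qed.

Lemma sqdist_bump_bump t a b c d i j k l :
  sqdist (bump t a b i j) (bump t c d k l) =
  a ^+ 2 + b ^+ 2 + c ^+ 2 + d ^+ 2
  + 2 * a * b * (i == j)%:R + 2 * c * d * (k == l)%:R
  - 2 * a * c * (i == k)%:R - 2 * a * d * (i == l)%:R
  - 2 * b * c * (j == k)%:R - 2 * b * d * (j == l)%:R.
Proof.
rewrite sqdist_bump.
(* Both vectors have the same base level t, so the remaining sum is the squared distance from the
   second one to a constant vector, and the same formula applies again. *)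
have -> : \sum_m (t - bump t c d k l 0 m) ^+ 2
       = sqdist (bump t c d k l) (const_mx t).
  by apply: eq_bigr => m _; rewrite [const_mx _ _ _]mxE -sqrrN opprB.
rewrite sqdist_bump big1 => [|m _]; last by rewrite mxE subrr expr0n.
by rewrite !mxE; ring.
Qed.

Lemma sum_in_bump t a b i j S :
  \sum_(k in S) bump t a b i j 0 k =
  #|S|%:R * t + a * (i \in S)%:R + b * (j \in S)%:R.
Proof.
rewrite big_mkcond /=.
rewrite -(sum_mul_delta (fun k => a * (k \in S)%:R)).
rewrite -(sum_mul_delta (fun k => b * (k \in S)%:R)).
rewrite -sum1_card natr_sum mulr_suml [X in X + _ + _]big_mkcond -!big_split.
by apply: eq_bigr => k _; rewrite mxE; case: (k \in S) => /=; ring.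
Qed.

Lemma sum_bump t a b i j : \sum_k bump t a b i j 0 k = n%:R * t + a + b.
Proof.
have := sum_in_bump t a b i j [set: 'I_n]%SET.
rewrite cardsT card_ord !inE !mulr1 => <-.
by apply: eq_bigl => k; rewrite inE.
Qed.

(** For sets S of a fixed size only the last sum varies, so differences of distances are differences
    of coordinate sums. *)
Lemma sqdist_indic x S :
  sqdist x (indic S) =
  \sum_k x 0 k ^+ 2 + #|S|%:R - 2 * \sum_(k in S) x 0 k.
Proof.
rewrite -sum1_card natr_sum -addrA mulr_sumr -sumrB [X in _ + X]big_mkcond -big_split.
by apply: eq_bigr => k _; rewrite !mxE; case: (k \in S) => /=; ring.
Qed.

Lemma sqdist_bump_indic t a b i j S :
  sqdist (bump t a b i j) (indic S) =
  n%:R * t ^+ 2 + (2 * t * (a + b) + a ^+ 2 + b ^+ 2 + 2 * a * b * (i == j)%:R)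
  + #|S|%:R * (1 - 2 * t) - 2 * (a * (i \in S)%:R + b * (j \in S)%:R).
Proof.
rewrite sqdist_indic sum_in_bump.
have -> : \sum_k bump t a b i j 0 k ^+ 2 = sqdist (bump t a b i j) 0.
  by apply: eq_bigr => k _; rewrite [X in _ - X]mxE subr0.
rewrite sqdist_bump; under eq_bigr do rewrite mxE subr0.
by rewrite sumr_const card_ord !mxE -mulr_natl; ring.
Qed.

End Vectors.

(** * Coordinates of a vector at allowed distances from the Johnson vectors *)

(* The squares of the three distances that occur in J~(n,3). *)
Definition allowed (R : realType) (d : R) : Prop := [\/ d = 2, d = 4 | d = 6].

Lemma exists_notin n (s : seq 'I_n) : (size s < n)%N -> exists k, k \notin s.
Proof.
move=> sn; apply: contrapT => h.
have : (size (enum 'I_n) <= size s)%N.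
  apply: uniq_leq_size; first exact: enum_uniq.
  by move=> k _; apply: contrapT => /negP ks; apply: h; exists k.
by rewrite size_enum_ord leqNgt sn.
Qed.

(** These are the halved differences of two numbers among 2, 4, 6. *)
Definition small_diff (R : realType) (d : R) : Prop :=
  d = - 2 \/ d = - 1 \/ d = 0 \/ d = 1 \/ d = 2.

Lemma small_diff_le (R : realType) (d : R) : small_diff d -> d <= 2.
Proof. by case=> [|[|[|[|]]]] ->; lra. Qed.

(** Deviations of the two exceptional coordinates from the common level, each unordered pair being
    listed in one order only. *)
Definition bump_shapes (R : realType) : seq (R * R) :=
  [:: (0, 0); (1, 0); (- 1, 0); (2, 0); (- 2, 0); (1, 1); (1, - 1); (- 1, - 1)].

Section Shape.
Variables (R : realType) (n : nat) (x : 'rV[R]_n).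
Hypothesis n6 : (6 <= n)%N.
Hypothesis diff3 : forall s t : seq 'I_n, uniq s -> uniq t -> size s = 3%N -> size t = 3%N ->
  small_diff (\sum_(i <- s) x 0 i - \sum_(i <- t) x 0 i).

(** Completing i and j by the same two further indices gives two 3-subsets whose sums differ by x_i
    - x_j. *)
Lemma small_diff1 i j : i != j -> small_diff (x 0 i - x 0 j).
Proof.
move=> ij.
have [k] := @exists_notin n [:: i; j] (leq_trans (isT : (2 < 6)%N) n6).
rewrite !inE !negb_or => /andP[ki kj].
have [l] := @exists_notin n [:: i; j; k] (leq_trans (isT : (3 < 6)%N) n6).
rewrite !inE !negb_or => /and3P[li lj lk].
have := @diff3 [:: i; k; l] [:: j; k; l].
rewrite /= !inE !negb_or ![i == _]eq_sym ![j == _]eq_sym [k == l]eq_sym ki li kj lj lk /=.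
move=> /(_ isT isT erefl erefl); rewrite !big_cons !big_nil.
by congr small_diff; ring.
Qed.

Lemma small_diff2 i j k l : uniq [:: i; j; k; l] ->
  small_diff (x 0 i - x 0 j + (x 0 k - x 0 l)).
Proof.
rewrite /= !inE !negb_or -!andbA => /and5P[ij ik il jk /and3P[jl kl _]].
have [m] := @exists_notin n [:: i; j; k; l] (leq_trans (isT : (4 < 6)%N) n6).
rewrite !inE !negb_or => /and4P[mi mj mk ml].
have := @diff3 [:: i; k; m] [:: j; l; m].
rewrite /= !inE !negb_or ![_ == m]eq_sym ik mi mk jl mj ml /=.
move=> /(_ isT isT erefl erefl); rewrite !big_cons !big_nil.
by congr small_diff; ring.
Qed.

(** If S is a singleton, any other index serves as second exceptional one, with deviation 0; if S is
    a pair, both deviations are a. *)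
Lemma two_level_shape t a (S : {set 'I_n}) : (0 < #|S| <= 2)%N ->
  (forall k, x 0 k = t + a * (k \in S)%:R) ->
  (a = 1 \/ a = - 1) ->
  exists i j u b c, [/\ i != j, x = bump u b c i j & (b, c) \in bump_shapes R].
Proof.
move=> S12 xS a1.
have [S1|S2] : (#|S| = 1 \/ #|S| = 2)%N.
- by case: #|S| S12 => [//|[|[|//]]] _; [left|right].
- have /cards1P[i Si] : #|S| == 1%N by rewrite S1.
  have [j ij] := @exists_notin n [:: i] (leq_trans (isT : (1 < 6)%N) n6).
  exists i, j, t, a, 0; split.
  + by rewrite eq_sym; rewrite inE in ij.
  + by apply/rowP => k; rewrite mxE xS Si inE mul0r addr0.
  + by case: a1 => ->; rewrite !inE !xpair_eqE !eqxx ?orbT.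
- have /cards2P[i [j [ij Sij]]] : #|S| == 2%N by rewrite S2.
  exists i, j, t, a, a; split => //.
  + apply/rowP => k; rewrite mxE xS Sij !inE.
    have [->|_] := eqVneq k i; first by rewrite (negbTE ij) /=; ring.
    by case: (k == j); rewrite /=; ring.
  + by case: a1 => ->; rewrite !inE !xpair_eqE !eqxx ?orbT.
Qed.

(* If two coordinates differ by 2, all others coincide; otherwise the
   coordinates take at most two values, and one of them at most twice. *)
Lemma shape : exists i j t a b,
  [/\ i != j, x = bump t a b i j & (a, b) \in bump_shapes R].
Proof.
have [[i [j dij]]|no2] := pselect (exists i j, x 0 i - x 0 j = 2).
  have ij : i != j by apply: contra_eqN dij => /eqP ->; rewrite subrr eq_sym pnatr_eq0.
  have [m] := @exists_notin n [:: i; j] (leq_trans (isT : (2 < 6)%N) n6).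
  rewrite !inE !negb_or => /andP[mi mj].
  have mid k : k != i -> k != j -> x 0 k = x 0 m.
    move=> ki kj; have [->//|km] := eqVneq k m.
    have u1 : uniq [:: i; j; k; m].
      by rewrite /= !inE !negb_or ![i == _]eq_sym ![j == _]eq_sym ki mi kj mj km ij.
    have u2 : uniq [:: i; j; m; k].
      by rewrite /= !inE !negb_or ![i == _]eq_sym ![j == _]eq_sym ki mi kj mj [m == k]eq_sym km ij.
    (* The two sums are 2 + (x_k - x_m) and 2 - (x_k - x_m); as neither exceeds 2, x_k = x_m. *)
    have := small_diff_le (small_diff2 u1); have := small_diff_le (small_diff2 u2).
    rewrite dij; lra.
  have xb a b : x 0 i = x 0 m + a -> x 0 j = x 0 m + b -> x = bump (x 0 m) a b i j.
    move=> xi xj; apply/rowP => k; rewrite mxE.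
    have [->|ki] := eqVneq k i; first by rewrite (negbTE ij) /= xi; ring.
    have [->|kj] := eqVneq k j; first by rewrite /= xj; ring.
    by rewrite mid //=; ring.
  have dj := small_diff1 mj.
  have im : i != m by rewrite eq_sym.
  have di : x 0 i - x 0 m <= 2 := small_diff_le (small_diff1 im).
  have [[xi xj]|[[xi xj]|[xi xj]]] :
      (x 0 i = x 0 m + 2 /\ x 0 j = x 0 m + 0) \/
      (x 0 i = x 0 m + 1 /\ x 0 j = x 0 m + - 1) \/
      (x 0 i = x 0 m + 0 /\ x 0 j = x 0 m + - 2).
  - by case: dj => [|[|[|[|]]]] dj; [exfalso|exfalso|left|right; left|right; right]; lra.
  - exists i, j, (x 0 m), 2, 0; split; [done|exact: xb|].
    by rewrite !inE !xpair_eqE !eqxx ?orbT.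
  - exists i, j, (x 0 m), 1, (- 1); split; [done|exact: xb|].
    by rewrite !inE !xpair_eqE !eqxx ?orbT.
  (* The shape (0, -2) is listed as (-2, 0), so i and j trade places. *)
  - exists j, i, (x 0 m), (- 2), 0; split; rewrite 1?eq_sym //; last first.
      by rewrite !inE !xpair_eqE !eqxx ?orbT.
    by apply: (etrans (xb _ _ xi xj)); apply/rowP => k; rewrite !mxE; ring.
have small k l : x 0 k - x 0 l = - 1 \/ x 0 k - x 0 l = 0 \/ x 0 k - x 0 l = 1.
  have [->|kl] := eqVneq k l; first by rewrite subrr; right; left.
  have n1 : x 0 k - x 0 l <> 2 by move=> h; apply: no2; exists k, l.
  have n2 : x 0 l - x 0 k <> 2 by move=> h; apply: no2; exists l, k.
  move: (small_diff1 kl) n1 n2; rewrite /small_diff => h n1 n2.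
  case: h => [h|[|[|[|//]]]]; [|by left|by right; left|by right; right].
  by exfalso; apply: n2; rewrite -opprB h opprK.
have [[i [j dij]]|no1] := pselect (exists i j, x 0 i - x 0 j = 1); last first.
  have i0 : 'I_n := Ordinal (leq_trans (isT : (0 < 6)%N) n6).
  have [j] := @exists_notin n [:: i0] (leq_trans (isT : (1 < 6)%N) n6).
  rewrite inE => ji.
  exists j, i0, (x 0 i0), 0, 0; split => //; last by rewrite !inE !xpair_eqE !eqxx.
  apply/rowP => k; rewrite mxE !mul0r !addr0.
  have n1 : x 0 k - x 0 i0 <> 1 by move=> h; apply: no1; exists k, i0.
  have n2 : x 0 i0 - x 0 k <> 1 by move=> h; apply: no1; exists i0, k.
  by case: (small k i0) => [|[|]]; lra.
(* No coordinate is more than 1 away from x_i or from x_j = x_i - 1, so each equals one of these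
   two; S is the upper level. *)
pose S := [set k | x 0 k == x 0 j + 1]%SET.
have inS k : k \in S -> x 0 k = x 0 j + 1 by rewrite inE => /eqP.
have notinS k : k \notin S -> x 0 k = x 0 j.
  by rewrite inE => /eqP; case: (small k i) => [|[|]]; case: (small k j) => [|[|]]; lra.
have iS : i \in S by rewrite inE; apply/eqP; move: dij; lra.
have jS : j \notin S by rewrite inE; apply/negP => /eqP; lra.
have [S2|S3] := leqP #|S| 2.
  apply: (@two_level_shape (x 0 j) 1 S); last by left.
    by rewrite S2 andbT; apply/card_gt0P; exists i.
  by move=> k; have [/inS ->|/notinS ->] := boolP (k \in S); rewrite ?mulr1 ?mulr0 ?addr0.
have [T2|T3] := leqP #|~: S| 2.
  apply: (@two_level_shape (x 0 j + 1) (- 1) (~: S)); last by right.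
    by rewrite T2 andbT; apply/card_gt0P; exists j; rewrite inE.
  move=> k; rewrite inE; have [/inS ->|/notinS ->] := boolP (k \in S); rewrite /=; ring.
(* Three upper and three lower coordinates would give two sums differing by 3. *)
have [a [b [c [[aS bS cS] [ab bc ca]]]]] := card_gt2P S3.
have [d [e [f [[]]]]] := card_gt2P T3; rewrite !inE -!/(~~ (_ \in S)).
move=> dS eS fS [de ef fd].
have := @diff3 [:: a; b; c] [:: d; e; f].
rewrite /= !inE !negb_or ab bc de ef [a == c]eq_sym [d == f]eq_sym ca fd.
move=> /(_ isT isT erefl erefl); rewrite !big_cons !big_nil.
rewrite (inS a aS) (inS b bS) (inS c cS) (notinS d) ?(notinS e) ?(notinS f) ?inE //.
by move=> /small_diff_le; lra.
Qed.

End Shape.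

(* [N] stands for n; the exception 3 N = 25 has no integer solution. *)
Lemma bump_solutions (R : realType) (N t a b Q : R) : 6 <= N ->
  (a, b) \in bump_shapes R -> N * t = 3 - a - b ->
  N * (a ^+ 2 + b ^+ 2 + 3 - Q) = (3 - a - b) ^+ 2 ->
  allowed Q -> allowed (Q - 2 * a) -> allowed (Q - 2 * (a + b)) ->
  [\/ [/\ N = 9, t = 1 / 3, a = 0 & b = 0],
      [/\ N = 8, t = 1 / 2, a = - 1 & b = 0],
      [/\ N = 9, t = 1 / 3, a = 1 & b = - 1]
    | 3 * N = 25].
Proof.
move=> N6 sh Nt NQ Q1 Q2 Q3.
have tE u c : N = u -> 3 - a - b = u * c -> 0 < u -> t = c.
  move=> Nu abu u0; apply: (mulfI (lt0r_neq0 u0)); by rewrite -abu -Nu.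
move: sh; rewrite !inE !xpair_eqE => sh; move: sh Nt NQ Q2 Q3 tE.
(* With a, b and Q numeric, [NQ] is linear in N. The last alternative arises from a = b = -1, Q =
   2. *)
case: Q1 => ->; do 7?[case/orP]; case/andP => /eqP -> /eqP -> Nt NQ Q2 Q3 tE;
  first [ by exfalso; lra
        | by exfalso; case: Q2; lra
        | by exfalso; case: Q3; lra
        | by constructor 1; have N9 : N = 9 by [lra]; split => //; apply: (tE 9); lra
        | by constructor 2; have N8 : N = 8 by [lra]; split => //; apply: (tE 8); lra
        | by constructor 3; have N9 : N = 9 by [lra]; split => //; apply: (tE 9); lra
        | by constructor 4; lra ].
Qed.

Lemma small_diff_allowed (R : realType) (q a b : R) :
  allowed (q - 2 * a) -> allowed (q - 2 * b) -> small_diff (a - b).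
Proof.
by case=> ha; case=> hb; first [left; lra | right; left; lra
  | right; right; left; lra | right; right; right; left; lra
  | right; right; right; right; lra].
Qed.

Lemma card_seq_set (T : finType) (s : seq T) :
  uniq s -> #|[set k in s]%SET| = size s.
Proof. by rewrite cardsE => /card_uniqP. Qed.

Lemma allowed_to_johnson_bump (R : realType) (n : nat) (x : 'rV[R]_n) :
  (6 <= n)%N -> \sum_k x 0 k = 3 ->
  (forall S : {set 'I_n}, #|S| = 3%N -> allowed (sqdist x (indic R S))) ->
  exists i j, i != j /\
    [\/ n = 9%N /\ x = bump (1 / 3) 0 0 i j,
        n = 8%N /\ x = bump (1 / 2) (- 1) 0 i j
      | n = 9%N /\ x = bump (1 / 3) 1 (- 1) i j].
Proof.
move=> n6 x3 xJ.
have [|i [j [t [a [b [ij xE ab]]]]]] := @shape R n x n6.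
  move=> s u us uu s3 u3.
  have hs w : uniq w -> size w = 3%N ->
      allowed (\sum_k x 0 k ^+ 2 + 3 - 2 * \sum_(k <- w) x 0 k).
    move=> uw w3; have := xJ [set k in w]%SET; rewrite sqdist_indic card_seq_set // w3.
    move=> /(_ erefl); congr allowed; congr (_ - 2 * _).
    by rewrite big_uniq //; apply: eq_bigl => k; rewrite inE.
  exact: small_diff_allowed (hs _ us s3) (hs _ uu u3).
(* Three spare indices suffice to form 3-subsets that meet {i, j} in the empty set, in {i}, and in
   {i, j}. *)
have [k] := @exists_notin n [:: i; j] (leq_trans (isT : (2 < 6)%N) n6).
rewrite !inE !negb_or ![k == _]eq_sym => /andP[/negbTE ik /negbTE jk].
have [l] := @exists_notin n [:: i; j; k] (leq_trans (isT : (3 < 6)%N) n6).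
rewrite !inE !negb_or ![l == _]eq_sym => /and3P[/negbTE il /negbTE jl /negbTE kl].
have [m] := @exists_notin n [:: i; j; k; l] (leq_trans (isT : (4 < 6)%N) n6).
rewrite !inE !negb_or ![m == _]eq_sym.
move=> /and4P[/negbTE im /negbTE jm /negbTE km /negbTE lm].
move: x3 xJ; rewrite xE sum_bump => nt xJ.
have Qs (u : seq 'I_n) : uniq u -> size u = 3%N ->
    allowed (n%:R * t ^+ 2 + (2 * t * (a + b) + a ^+ 2 + b ^+ 2) + 3 * (1 - 2 * t)
             - 2 * (a * (i \in u)%:R + b * (j \in u)%:R)).
  move=> uu u3; have := xJ [set r in u]%SET.
  rewrite card_seq_set // sqdist_bump_indic card_seq_set // u3 (negbTE ij) mulr0 addr0 !inE.
  by move=> /(_ erefl).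
set Q := _ + 3 * _ in Qs.
have ji : (j == i) = false by rewrite eq_sym (negbTE ij).
have eqs := (ik, jk, il, jl, kl, im, jm, km, lm, ji, negbTE ij, eqxx).
have Q1 : allowed Q.
  have := Qs [:: k; l; m]; rewrite /= !inE !eqs /= => /(_ isT erefl).
  by congr allowed; ring.
have Q2 : allowed (Q - 2 * a).
  have := Qs [:: i; k; l]; rewrite /= !inE !eqs /= => /(_ isT erefl).
  by congr allowed; ring.
have Q3 : allowed (Q - 2 * (a + b)).
  have := Qs [:: i; j; k]; rewrite /= !inE !eqs /= => /(_ isT erefl).
  by congr allowed; ring.
have nt' : n%:R * t = 3 - a - b by rewrite -nt; ring.
have NQ : n%:R * (a ^+ 2 + b ^+ 2 + 3 - Q) = (3 - a - b) ^+ 2.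
  (* After multiplication by n, t enters only through n t, which [nt'] eliminates. *)
  transitivity (- ((n%:R * t) ^+ 2 + 2 * (n%:R * t) * (a + b) - 6 * (n%:R * t))).
    by rewrite /Q; ring.
  by rewrite nt'; ring.
have N6 : (6 : R) <= n%:R by rewrite (ler_nat R 6).
exists i, j; split=> //.
have [[n9 -> -> ->]|[n8 -> -> ->]|[n9 -> -> ->]|/eqP] := bump_solutions N6 ab nt' NQ Q1 Q2 Q3.
- by constructor 1; split=> //; apply/eqP; rewrite -(eqr_nat R) n9.
- by constructor 2; split=> //; apply/eqP; rewrite -(eqr_nat R) n8.
- by constructor 3; split=> //; apply/eqP; rewrite -(eqr_nat R) n9.
(* 25 is not divisible by 3. *)
- by rewrite -natrM eqr_nat => /eqP h; have := congr1 (modn^~ 3) h; rewrite modnMr.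
Qed.

(** * Three-distance sets containing the Johnson vectors *)

Lemma subset_card_eq (T : choiceType) (m : nat) (A B : set T) :
  (A #= `I_m)%card -> (B #= `I_m)%card -> A `<=` B -> A = B.
Proof.
move=> Am Bm AB.
have fA : finite_set A by apply/finite_setP; exists m.
have fB : finite_set B by apply/finite_setP; exists m.
rewrite -(fset_setK fA) -(fset_setK fB); suff -> : fset_set A = fset_set B by [].
apply/eqP; rewrite eqEfcard (card_fset_set Am) (card_fset_set Bm) leqnn andbT.
by rewrite -fset_set_sub.
Qed.

Lemma card_image_finset (T : finType) (U : Type) (f : T -> U) (P : {set T}) :
  {in P &, injective f} -> ([set f t | t in [set` P]] #= `I_#|P|)%card.
Proof.
move=> finj; have -> : [set f t | t in [set` P]] = [set f (enum_val i) | i in [set: 'I_#|P|]].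
  apply/seteqP; split=> [_ [t tP <-]|_ [i _ <-]].
    by exists (enum_rank_in tP t); rewrite // enum_rankK_in.
  by exists (enum_val i) => //; exact: enum_valP.
apply: card_eq_trans (card_esym card_II).
apply: inj_card_eq => i j _ _ /finj ij.
by apply: enum_val_inj; apply: ij; exact: enum_valP.
Qed.

Lemma card_eq_setU (T : choiceType) (m p : nat) (A B : set T) :
  (A #= `I_m)%card -> (B #= `I_p)%card -> A `&` B = set0 ->
  (A `|` B #= `I_(m + p))%card.
Proof.
move=> Am Bp AB.
have fA : finite_set A by apply/finite_setP; exists m.
have fB : finite_set B by apply/finite_setP; exists p.
rewrite -(@fset_setK _ (A `|` B)) ?finite_setU //; apply/card_eq_fsetP.
rewrite fset_setU // cardfsU -fset_setI // AB fset_set0 cardfs0 subn0.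
by rewrite (card_fset_set Am) (card_fset_set Bp).
Qed.

Section ThreeDistance.
Variables (R : realType) (n : nat).
Implicit Types (S T : {set 'I_n}) (x y : 'rV[R]_n).

Lemma indic_inj : injective (@indic R n).
Proof.
move=> S T /rowP ST; apply/setP => i; have := ST i; rewrite !mxE.
by case: (i \in S); case: (i \in T) => // /eqP; rewrite ?oner_eq0 // eq_sym oner_eq0.
Qed.

Lemma sum_indic S : \sum_k indic R S 0 k = #|S|%:R.
Proof.
rewrite -sum1_card natr_sum [RHS]big_mkcond.
by apply: eq_bigr => k _; rewrite mxE; case: ifP.
Qed.

Lemma sqdist_indic_indic S T :
  sqdist (indic R S) (indic R T) = #|S|%:R + #|T|%:R - 2 * #|S :&: T|%:R.
Proof.
rewrite sqdist_indic -(sum_indic S); congr (_ + _ - 2 * _).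
    by apply: eq_bigr => k _; rewrite mxE; case: ifP; rewrite ?expr1n ?expr0n.
rewrite -sum1_card natr_sum [LHS]big_mkcond [RHS]big_mkcond; apply: eq_bigr => k _.
by rewrite !mxE inE; case: (k \in S); case: (k \in T).
Qed.

Lemma allowed_sqdist_indic S T : #|S| = 3%N -> #|T| = 3%N -> S <> T ->
  allowed (sqdist (indic R S) (indic R T)).
Proof.
move=> S3 T3 ST; rewrite sqdist_indic_indic S3 T3.
have : (#|S :&: T| < 3)%N.
  rewrite ltn_neqAle -[X in (_ <= X)%N]S3 subset_leq_card ?subsetIl // andbT.
  apply/negP => /eqP c3; apply: ST; transitivity (S :&: T).
    by apply/esym/eqP; rewrite eqEcard subsetIl c3 S3.
  by apply/eqP; rewrite eqEcard subsetIr c3 T3.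
case: #|S :&: T| => [|[|[|//]]] _; [constructor 3|constructor 2|constructor 1]; ring.
Qed.

Lemma euclidean_distE x y : euclidean_dist x y = Num.sqrt (sqdist x y).
Proof. by []. Qed.

(** The square roots of 2, 4, 6, written as an image of [I_3] so that counting them reduces to
    injectivity. *)
Definition three_distances : set R := [set Num.sqrt (2 * k.+1)%:R | k in `I_3].

Lemma card_three_distances : (three_distances #= `I_3)%card.
Proof.
apply: inj_card_eq => k l _ _ /eqP.
by rewrite eqr_sqrt ?ler0n // eqr_nat eqn_pmul2l // eqSS => /eqP.
Qed.

Lemma three_distances_sqrt (d : R) : 0 <= d ->
  three_distances (Num.sqrt d) <-> allowed d.
Proof.
move=> d0; split.
  move=> [k k3 /eqP]; rewrite eqr_sqrt ?ler0n // => /eqP <-.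
  by case: k k3 => [|[|[|//]]] _; [constructor 1|constructor 2|constructor 3].
by case=> ->; [exists 0%N|exists 1%N|exists 2%N].
Qed.

Lemma johnson3E x : (6 <= n)%N ->
  johnson R n 3 x <-> exists2 S : {set 'I_n}, #|S| = 3%N & x = indic R S.
Proof. by move=> n6; apply: johnsonE; exact: leq_trans n6. Qed.

(** Two 3-subsets meeting in 2 - k points are at squared distance 2(k + 1), and for k = 0, 1, 2 such
    pairs exist among the first six indices. *)
Lemma three_distances_sub_johnson : (6 <= n)%N ->
  three_distances `<=` distances (johnson R n 3).
Proof.
move=> n6 _ [k k3 <-].
pose o (m : 'I_6) : 'I_n := widen_ord n6 m.
have oinj : injective o by move=> a b /(congr1 val) /= ab; exact: val_inj.
have card_o (s : seq 'I_6) : uniq s -> #|[set r in map o s]%SET| = size s.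
  by move=> us; rewrite card_seq_set ?map_inj_uniq // size_map.
pose u (m : nat) : 'I_6 := inord m.
pose s := [:: u 0%N; u 1%N; u 2%N].
have [t [ut t3 st]] : exists t, [/\ uniq t, size t = 3%N
    & count (mem s) t = (2 - k)%N].
  have uE a b : (a < 6)%N -> (b < 6)%N -> (u a == u b) = (a == b).
    by move=> a6 b6; rewrite -val_eqE /= !inordK.
  case: k k3 => [|[|[|//]]] _;
    [exists [:: u 0%N; u 1%N; u 3%N]|exists [:: u 0%N; u 3%N; u 4%N]
    |exists [:: u 3%N; u 4%N; u 5%N]]; by rewrite /= !inE !uE.
have us : uniq s by rewrite /= !inE -!val_eqE /= !inordK.
pose S := [set r in map o s]%SET; pose T := [set r in map o t]%SET.
have ST : #|S :&: T| = (2 - k)%N.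
  rewrite -st -size_filter -(card_o _ (filter_uniq _ ut)); apply: eq_card => r.
  apply/idP/idP; rewrite !finset.in_set.
    by move=> /andP[/mapP[a sa ->]]; rewrite !mem_map // mem_filter /= sa.
  by move=> /mapP[a]; rewrite mem_filter => /andP[sa ta] ->; rewrite !mem_map // ta andbT.
exists (indic R S), (indic R T); split.
- by apply/johnson3E => //; exists S => //; exact: card_o.
- by apply/johnson3E => //; exists T => //; rewrite card_o.
(* Equal sets would meet in 3 points, more than 2 - k. *)
- move=> /indic_inj STe; move: ST; rewrite -STe finset.setIid card_o // /s /= => k2.
  by have := leq_subr k 2; rewrite -k2.
- rewrite euclidean_distE sqdist_indic_indic ST !card_o // t3; congr Num.sqrt.
  clear -k3; rewrite natrM natrB // -natr1.
  by case: k k3 => [|[|[|//]]] _ /=; ring.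
Qed.

(** The Johnson vectors already realize three distances, so having exactly three means having no
    other. *)
Lemma three_distance_setP (A : set 'rV[R]_n) : (6 <= n)%N ->
  johnson R n 3 `<=` A ->
  s_distance_set 3 A <->
  finite_set A /\ forall x y, A x -> A y -> x <> y -> allowed (sqdist x y).
Proof.
move=> n6 JA; have DA : three_distances `<=` distances A.
  apply: subset_trans (three_distances_sub_johnson n6) _ => d [x [y [Jx Jy xy ->]]].
  by exists x, y; split=> //; exact: JA.
split=> -[fA]; last first.
  move=> AA; split=> //; suff <- : three_distances = distances A by exact: card_three_distances.
  apply/seteqP; split=> // _ [x [y [Ax Ay xy ->]]].
  by rewrite euclidean_distE; apply/three_distances_sqrt; [exact: sqdist_ge0|exact: AA].
move=> A3; split=> // x y Ax Ay xy.
apply/three_distances_sqrt; first exact: sqdist_ge0.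
by rewrite (subset_card_eq card_three_distances A3 DA); exists x, y.
Qed.

End ThreeDistance.

(** Take i where x has the entry a and j where it has c; cancelling these two entries leaves a
    constant list. *)
Lemma permvecs_bump (R : realType) (n m : nat) (a b c : R) (x : 'rV[R]_n) :
  a != c -> m.+2 = n ->
  permvecs n [:: (a, 1%N); (b, m); (c, 1%N)] x <->
  exists i j, i != j /\ x = bump b (a - b) (c - b) i j.
Proof.
move=> ac mn.
pose rest (i j : 'I_n) := enum (~: [set i; j]%SET).
have permE i j : i != j ->
    perm_eq [seq x 0 k | k <- enum 'I_n] (x 0 i :: x 0 j :: [seq x 0 k | k <- rest i j]).
  move=> ij; apply: (@perm_map _ _ (fun k => x 0 k) _ ([:: i; j] ++ rest i j)).
  apply: perm_trans (perm_eq_enum_setC [set i; j]%SET) _; rewrite perm_cat2r.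
  apply: uniq_perm; rewrite ?enum_uniq //= ?inE ?ij // => k.
  by rewrite mem_enum !inE.
have flatE : perm_eq (flatten [seq nseq ar.2 ar.1 | ar <- [:: (a, 1%N); (b, m); (c, 1%N)]])
    (a :: c :: nseq m b).
  by rewrite /= perm_cons perm_catC.
rewrite /permvecs /=; split.
  move=> px; have {}px := perm_trans px flatE.
  have mem d : d \in a :: c :: nseq m b -> exists i, x 0 i = d.
    by rewrite -(perm_mem px) => /mapP[i _ ->]; exists i.
  have [i xi] : exists i, x 0 i = a by apply: mem; rewrite !inE eqxx.
  have [j xj] : exists j, x 0 j = c by apply: mem; rewrite !inE eqxx orbT.
  have ij : i != j by apply: contraNneq ac => ij; rewrite -xi ij xj.
  exists i, j; split=> //; apply/rowP => k; rewrite mxE.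
  have [->|ki] := eqVneq k i; first by rewrite (negbTE ij) /= xi; ring.
  have [->|kj] := eqVneq k j; first by rewrite /= xj; ring.
  move: px; rewrite (permPl (permE i j ij)) xi xj !perm_cons => /perm_mem /(_ (x 0 k)).
  rewrite map_f; last by rewrite mem_enum !inE negb_or ki kj.
  by rewrite mem_nseq => /esym/andP[_ /eqP ->] /=; ring.
move=> [i [j [ij xE]]]; apply: perm_trans (permE i j ij) _.
rewrite perm_sym; apply: perm_trans flatE _; rewrite perm_sym.
have -> : x 0 i = a by rewrite xE mxE eqxx (negbTE ij) /=; ring.
have -> : x 0 j = c by rewrite xE mxE eqxx eq_sym (negbTE ij) /=; ring.
rewrite !perm_cons (@map_enum_const _ _ _ _ b).
  have := cardsC [set i; j]%SET; rewrite cards2 ij card_ord -[RHS]mn => /eqP.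
  by rewrite addSn add1n !eqSS => /eqP ->.
move=> k; rewrite !inE negb_or => /andP[ki kj].
by rewrite xE mxE (negbTE ki) (negbTE kj) /=; ring.
Qed.

Lemma card_johnson (R : realType) (n k : nat) : (k <= n)%N ->
  (johnson R n k #= `I_'C(n, k))%card.
Proof.
move=> kn; rewrite -[n in 'C(n, k)]card_ord -card_draws.
suff -> : johnson R n k = [set indic R t | t in [set` [set A : {set 'I_n} | #|A| == k]%SET]].
  by apply: card_image_finset => S T _ _ /indic_inj.
apply/seteqP; split=> [x /(johnsonE _ kn)[S Sk ->]|_ [S /= Sk <-]].
  by exists S => //=; rewrite inE Sk.
by apply/(johnsonE _ kn); exists S => //; apply/eqP; rewrite inE in Sk.
Qed.

(** Having two arguments lets a union be checked block by block, each block against itself and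
    against the other. *)
Definition allowed_on (R : realType) (n : nat) (A B : set 'rV[R]_n) : Prop :=
  forall x y, A x -> B y -> x <> y -> allowed (sqdist x y).

Lemma allowed_on_setU (R : realType) (n : nat) (A B : set 'rV[R]_n) :
  allowed_on A A -> allowed_on B B -> allowed_on A B ->
  allowed_on (A `|` B) (A `|` B).
Proof.
move=> AA BB AB x y [Ax|Bx] [Ay|By] xy; [exact: AA|exact: AB| |exact: BB].
by rewrite sqdistC; apply: AB => //; exact: nesym.
Qed.

Section Johnson3.
Variables (R : realType) (n : nat).
Hypothesis n6 : (6 <= n)%N.
Local Notation J := (johnson R n 3).
Local Notation H := (hyperplane R n 3).

Lemma johnson_sub_hyperplane : J `<=` H.
Proof. by move=> _ /(johnson3E _ n6)[S S3 ->]; rewrite /hyperplane /= sum_indic S3. Qed.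

Lemma allowed_on_johnson : allowed_on J J.
Proof.
move=> _ _ /(johnson3E _ n6)[S S3 ->] /(johnson3E _ n6)[T T3 ->] ST.
by apply: allowed_sqdist_indic => // STe; apply: ST; rewrite STe.
Qed.

Lemma finite_johnson : finite_set J.
Proof.
apply/finite_setP; exists 'C(n, 3).
by apply: card_johnson; exact: leq_trans n6.
Qed.

Lemma allowed_bump_johnson t a b i j :
  (forall S : {set 'I_n}, #|S| = 3%N -> allowed (sqdist (bump t a b i j) (indic R S))) ->
  forall y, J y -> allowed (sqdist (bump t a b i j) y).
Proof. by move=> h _ /(johnson3E _ n6)[S S3 ->]; exact: h. Qed.

(** A point of B outside J differs from every Johnson vector, so all its distances to them are
    allowed and the classification applies. *)
Lemma three_distance_superset (B : set 'rV[R]_n) :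
  B `<=` H -> s_distance_set 3 B -> J `<=` B ->
  forall x, B x -> J x \/ exists i j, i != j /\
    [\/ n = 9%N /\ x = bump (1 / 3) 0 0 i j,
        n = 8%N /\ x = bump (1 / 2) (- 1) 0 i j
      | n = 9%N /\ x = bump (1 / 3) 1 (- 1) i j].
Proof.
move=> BH B3 JB x Bx; have [Jx|nJx] := pselect (J x); [by left|right].
apply: allowed_to_johnson_bump => //; first exact: (BH _ Bx).
have [_ BB] := (three_distance_setP n6 JB).1 B3.
move=> S S3; have JS : J (indic R S) by apply/johnson3E => //; exists S.
by apply: BB => //; [exact: JB|move=> xS; apply: nJx; rewrite xS].
Qed.

Lemma three_distance_setU1 (A : set 'rV[R]_n) y :
  J `<=` A -> s_distance_set 3 A ->
  (forall x, A x -> x <> y -> allowed (sqdist x y)) ->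
  s_distance_set 3 (A `|` [set y]).
Proof.
move=> JA A3 Ay; have [fA AA] := (three_distance_setP n6 JA).1 A3.
apply/three_distance_setP => //; first by move=> x Jx; left; exact: JA.
split; first by rewrite finite_setU; split => //; exact: finite_set1.
apply: allowed_on_setU => //; first by move=> x z -> ->.
by move=> x z Ax ->; exact: Ay.
Qed.

End Johnson3.

(** * Dimension eight *)

Lemma johnson_maximal (R : realType) (n : nat) :
  (6 <= n)%N -> n <> 8%N -> n <> 9%N ->
  maximal_s_distance_set 3 (hyperplane R n 3) (johnson R n 3).
Proof.
move=> n6 n8 n9; split; first exact: johnson_sub_hyperplane.
  by apply/three_distance_setP => //; split; [exact: finite_johnson|exact: allowed_on_johnson].
move=> B BH B3 JB; apply/seteqP; split=> // x Bx.
by have [//|[i [j [_ [[]|[]|[]]]]]] := three_distance_superset n6 BH B3 JB Bx.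
Qed.

Section Eight.
Variable R : realType.
Local Notation J := (johnson R 8 3).
Local Notation H := (hyperplane R 8 3).
Local Notation Z := (permvecs 8 [:: (1 / 2, 7%N); (- (1 / 2), 1%N)] : set 'rV[R]_8).
Local Notation z i := (bump (1 / 2) (- 1) 0 i i : 'rV[R]_8).

Lemma half_neq_opp : 1 / 2 != - (1 / 2) :> R.
Proof. by apply/eqP; lra. Qed.

Lemma permvecs8E x : Z x <-> exists i, x = z i.
Proof.
split=> [/(@permvecs_two_valued R 8 _ _ 7 1 _ half_neq_opp erefl)[S S7 ->]|[i ->]].
  have /cards1P[i Si] : #|~: S| == 1%N.
    by have := cardsC S; rewrite S7 card_ord => /(@addnI 7 _ 1) ->.
  exists i; apply/rowP => k; rewrite !mxE.
  have -> : (k \in S) = (k != i) by rewrite -[S]finset.setCK Si !inE.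
  by case: (k == i) => /=; lra.
apply/(@permvecs_two_valued R 8 _ _ 7 1 _ half_neq_opp erefl); exists (~: [set i]%SET).
  by have := cardsC [set i]%SET; rewrite cards1 card_ord => /(@addnI 1 _ 7).
apply/rowP => k; rewrite !mxE !inE.
by case: (k == i) => /=; lra.
Qed.

(** Distinct vectors of Z are at squared distance 2; [z i] is at squared distance 4 from 1_S if i is
    in S, and 2 otherwise. *)
Lemma allowed_on_johnson8 : allowed_on (J `|` Z) (J `|` Z).
Proof.
apply: allowed_on_setU; first exact: allowed_on_johnson.
- move=> _ _ /permvecs8E[i ->] /permvecs8E[j ->] ij; constructor 1.
  rewrite sqdist_bump_bump; have [e|_] := eqVneq i j; last by rewrite /=; ring.
  by case: ij; rewrite e.
- move=> x _ Jx /permvecs8E[i ->] _; rewrite sqdistC.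
  apply: allowed_bump_johnson Jx => // S S3; rewrite sqdist_bump_indic S3 eqxx.
  by case: (i \in S); [constructor 2|constructor 1]; rewrite /=; field.
Qed.

Lemma johnson8_sub : J `|` Z `<=` H.
Proof.
move=> x [Jx|/permvecs8E[i ->]]; first exact: johnson_sub_hyperplane.
by rewrite /hyperplane /= sum_bump; field.
Qed.

Lemma card_permvecs8 : (Z #= `I_8)%card.
Proof.
have -> : Z = [set z i | i in [set` [set: 'I_8]%SET]].
  apply/seteqP; split=> [x /permvecs8E[i ->]|_ [i _ <-]]; last by apply/permvecs8E; exists i.
  by exists i => //=; rewrite inE.
rewrite -[X in `I_X](card_ord 8) -cardsT; apply: card_image_finset => i j _ _.
move=> /rowP /(_ i); rewrite !mxE eqxx /=; have [//|_] := eqVneq i j.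
by move=> /= h; exfalso; move: h; lra.
Qed.

(** 64 = 56 + 8. The sets are disjoint, since [z i] has the entry -1/2 at i. *)
Lemma card_johnson8 : (J `|` Z #= `I_64)%card.
Proof.
apply: (@card_eq_setU _ 'C(8, 3) 8); [exact: card_johnson|exact: card_permvecs8|].
apply/seteqP; split=> // x [/johnson3E[//|S S3 ->] /permvecs8E[i /rowP /(_ i)]].
by rewrite !mxE eqxx; case: (i \in S) => /=; lra.
Qed.

Lemma three_distance_johnson8 : s_distance_set 3 (J `|` Z).
Proof.
apply/three_distance_setP; [by []|by move=> x; left|].
split; last exact: allowed_on_johnson8.
by apply/finite_setP; exists 64%N; exact: card_johnson8.
Qed.

Lemma three_distance_sub_johnson8 (B : set 'rV[R]_8) :
  B `<=` H -> s_distance_set 3 B -> J `<=` B -> B `<=` J `|` Z.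
Proof.
move=> BH B3 JB x Bx.
have [Jx|[i [j [_ [[]|[_ ->]|[]]]]]] // := @three_distance_superset R 8 isT B BH B3 JB x Bx.
  by left.
by right; apply/permvecs8E; exists i; apply/rowP => k; rewrite !mxE; ring.
Qed.

(** The union is itself a three-distance set and contains every three-distance superset of J in H: a
    greatest element is the only maximal one. *)
Lemma maximal_johnson8P (A : set 'rV[R]_8) :
  maximal_s_distance_set 3 H A /\ J `<=` A <-> A = J `|` Z.
Proof.
split=> [[[AH A3 Amax] JA]|->].
  apply/esym/Amax; [exact: johnson8_sub|exact: three_distance_johnson8|].
  exact: three_distance_sub_johnson8.
have JE : J `<=` J `|` Z by left.
split=> //; split; [exact: johnson8_sub|exact: three_distance_johnson8|].
move=> B BH B3 EB; apply/seteqP; split=> //.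
by apply: three_distance_sub_johnson8 => //; exact: subset_trans EB.
Qed.

End Eight.

(** * Dimension nine *)

(* [y i j] is x0 + e_i - e_j, so that Y consists of the [y i j] with i != j. *)
Section Nine.
Variable R : realType.
Local Notation J := (johnson R 9 3).
Local Notation H := (hyperplane R 9 3).
Local Notation c := (center9 R).
Local Notation Y := (Y9 R).
Local Notation y i j := (bump (1 / 3) 1 (- 1) i j : 'rV[R]_9).
Implicit Types (i j : 'I_9) (v w : 'rV[R]_9).

Lemma Y9P v : Y v <-> exists i j, i != j /\ v = y i j.
Proof.
have ab : 4 / 3 != - (2 / 3) :> R by apply/eqP; lra.
have := @permvecs_bump R 9 7 _ (1 / 3) _ v ab erefl.
have -> : 4 / 3 - 1 / 3 = 1 :> R by field.
have -> : - (2 / 3) - 1 / 3 = - 1 :> R by field.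
exact.
Qed.

Lemma center9E i j : c = bump (1 / 3) 0 0 i j.
Proof. by apply/rowP => k; rewrite !mxE; ring. Qed.

Lemma reflect_bump9 i j : reflect_pt c (y i j) = y j i.
Proof. by apply/rowP => k; rewrite !mxE; field. Qed.

Lemma bump9_neq i j : i != j -> y i j <> y j i.
Proof.
by move=> ij /rowP /(_ i); rewrite !mxE eqxx (negbTE ij) /=; lra.
Qed.

Lemma bump9_neq_center i j : i != j -> y i j <> c.
Proof.
by move=> ij /rowP /(_ i); rewrite !mxE eqxx (negbTE ij) /=; lra.
Qed.

Lemma reflect_ptK v : reflect_pt c (reflect_pt c v) = v.
Proof. by rewrite /reflect_pt opprB addrC subrK. Qed.

Lemma Y9_reflect v : Y v -> Y (reflect_pt c v).
Proof.
move=> /Y9P[i [j [ij ->]]]; rewrite reflect_bump9; apply/Y9P; exists j, i.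
by rewrite eq_sym.
Qed.

Lemma Y9_reflect_neq v : Y v -> reflect_pt c v <> v.
Proof.
by move=> /Y9P[i [j [ij ->]]]; rewrite reflect_bump9; apply: nesym; exact: bump9_neq.
Qed.

(** Two roots that are neither equal nor opposite have inner product 1, 0 or -1, which gives squared
    distance 2, 4 or 6. *)
Lemma allowed_bump9 i j k l : i != j -> k != l -> y i j <> y k l -> y i j <> y l k ->
  allowed (sqdist (y i j) (y k l)).
Proof.
move=> ij kl n1 n2; rewrite sqdist_bump_bump (negbTE ij) (negbTE kl).
have [ik|_] := eqVneq i k; have [jl|_] := eqVneq j l.
- by case: n1; rewrite ik jl.
- have -> : (i == l) = false by rewrite ik (negbTE kl).
  have -> : (j == k) = false by rewrite -ik eq_sym (negbTE ij).
  by constructor 1; rewrite /=; ring.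
- have -> : (i == l) = false by rewrite -jl (negbTE ij).
  have -> : (j == k) = false by rewrite jl eq_sym (negbTE kl).
  by constructor 1; rewrite /=; ring.
have [il|_] := eqVneq i l; have [jk|_] := eqVneq j k.
- by case: n2; rewrite il jk.
- by constructor 3; rewrite /=; ring.
- by constructor 3; rewrite /=; ring.
- by constructor 2; rewrite /=; ring.
Qed.

(** Opposite roots are at squared distance 8. *)
Lemma not_allowed_reflect v : Y v -> ~ allowed (sqdist v (reflect_pt c v)).
Proof.
move=> /Y9P[i [j [ij ->]]]; rewrite reflect_bump9 sqdist_bump_bump !eqxx.
rewrite [j == i]eq_sym (negbTE ij) /=.
by case; lra.
Qed.

Lemma allowed_Y9 v w : Y v -> Y w -> w <> v -> w <> reflect_pt c v ->
  allowed (sqdist w v).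
Proof.
move=> /Y9P[i [j [ij ->]]] /Y9P[k [l [kl ->]]]; rewrite reflect_bump9 => n1 n2.
exact: allowed_bump9.
Qed.

(** The squared distance is 4, less 2 if i is in S, plus 2 if j is in S. *)
Lemma allowed_johnson_Y9 : allowed_on J Y.
Proof.
move=> v _ Jv /Y9P[i [j [ij ->]]] _; rewrite sqdistC.
apply: allowed_bump_johnson Jv => // S S3.
rewrite sqdist_bump_indic S3 (negbTE ij).
case: (i \in S); case: (j \in S) => /=;
  [constructor 2|constructor 1|constructor 3|constructor 2]; by field.
Qed.

Lemma allowed_johnson_center : allowed_on J [set c].
Proof.
move=> v _ Jv -> _; rewrite sqdistC (center9E ord0 ord0).
apply: allowed_bump_johnson Jv => // S S3.
by rewrite sqdist_bump_indic S3; constructor 1; field.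
Qed.

Lemma allowed_center_Y9 : allowed_on [set c] Y.
Proof.
move=> _ _ -> /Y9P[i [j [ij ->]]] _; rewrite (center9E i j) sqdist_bump_bump (negbTE ij).
by constructor 1; rewrite /=; ring.
Qed.

Lemma johnson9_sub : J `|` [set c] `|` Y `<=` H.
Proof.
move=> v [[Jv|->]|/Y9P[i [j [_ ->]]]]; first exact: johnson_sub_hyperplane.
  by rewrite (center9E ord0 ord0) /hyperplane /= sum_bump; field.
by rewrite /hyperplane /= sum_bump; field.
Qed.

(** Unlike for n = 8, this bound is not itself a three-distance set, because Y contains opposite
    pairs. *)
Lemma three_distance_sub_johnson9 (B : set 'rV[R]_9) :
  B `<=` H -> s_distance_set 3 B -> J `<=` B -> B `<=` J `|` [set c] `|` Y.
Proof.
move=> BH B3 JB v Bv.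
have [Jv|[i [j [ij [[_ ->]|[]|[_ ->]]]]]] // := @three_distance_superset R 9 isT B BH B3 JB v Bv.
- by left; left.
- by left; right; rewrite (center9E i j).
- by right; apply/Y9P; exists i, j.
Qed.

Lemma finite_Y9 : finite_set Y.
Proof.
have : finite_set [set y p.1 p.2 | p in [set: 'I_9 * 'I_9]].
  by apply: finite_image; exact: finite_finset.
by apply: sub_finite_set => _ /Y9P[i [j [_ ->]]]; exists (i, j).
Qed.

(** Uniqueness within the pair of v would make v equal to its reflection. *)
Lemma transversal9_unique (Y' : set 'rV[R]_9) v :
  transversal9 Y' -> Y' v -> ~ Y' (reflect_pt c v).
Proof.
move=> [Y'Y Yu] Y'v Y'r; have [|u [_ uu]] := Yu [set v; reflect_pt c v].
  by exists v => //; exact: Y'Y.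
have e1 := uu v (conj (or_introl erefl) Y'v).
have e2 := uu (reflect_pt c v) (conj (or_intror erefl) Y'r).
by apply: (Y9_reflect_neq (Y'Y _ Y'v)); rewrite -e2 -e1.
Qed.

Lemma transversal9_exists (Y' : set 'rV[R]_9) v :
  transversal9 Y' -> Y v -> Y' v \/ Y' (reflect_pt c v).
Proof.
move=> [Y'Y Yu] Yv; have [|u [[[->|->] Y'u] _]] := Yu [set v; reflect_pt c v].
- by exists v.
- by left.
- by right.
Qed.

Lemma three_distance_extension9 (Y' : set 'rV[R]_9) :
  transversal9 Y' -> s_distance_set 3 (extension9 Y').
Proof.
move=> tY; have Y'Y := tY.1.
apply/three_distance_setP; [by []|by move=> v; left; left|split].
  rewrite !finite_setU; split; last by apply: sub_finite_set finite_Y9.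
  by split; [exact: finite_johnson|exact: finite_set1].
apply: allowed_on_setU.
- apply: allowed_on_setU; [exact: allowed_on_johnson|by move=> ? ? -> ->|].
  exact: allowed_johnson_center.
- move=> v w Y'v Y'w vw; apply: allowed_Y9 => //; [exact: Y'Y|exact: Y'Y|].
  by move=> vr; apply: (transversal9_unique tY Y'w); rewrite -vr.
- move=> v w [Jv|cv] Y'w; [apply: allowed_johnson_Y9|apply: allowed_center_Y9] => //; exact: Y'Y.
Qed.

(** A new point could only come from Y; its opposite then lies in Y', at a forbidden distance. *)
Lemma maximal_extension9 (Y' : set 'rV[R]_9) :
  transversal9 Y' -> maximal_s_distance_set 3 H (extension9 Y').
Proof.
move=> tY; have Y'Y := tY.1; split.
- by apply: subset_trans johnson9_sub => v [|Y'v]; [left|right; exact: Y'Y].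
- exact: three_distance_extension9.
move=> B BH B3 EB; have JB : J `<=` B by move=> v Jv; apply: EB; left; left.
have [_ BB] := (@three_distance_setP R 9 B isT JB).1 B3.
apply/seteqP; split=> // v Bv.
have [Jcv|Yv] := three_distance_sub_johnson9 BH B3 JB Bv; first by left.
have [Y'v|Y'r] := transversal9_exists tY Yv; first by right.
exfalso; apply: (not_allowed_reflect Yv); apply: BB => //; first by apply: EB; right.
by apply: nesym; exact: Y9_reflect_neq.
Qed.

(** Adjoining v creates no new distance, so by maximality v is already present. *)
Lemma maximal_johnson9_mem (A : set 'rV[R]_9) v :
  maximal_s_distance_set 3 H A -> J `<=` A -> H v ->
  (forall w, A w -> w <> v -> allowed (sqdist w v)) -> A v.
Proof.
move=> [AH A3 Amax] JA Hv Av.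
suff <- : A `|` [set v] = A by right.
apply: Amax; [|exact: three_distance_setU1|by left].
by move=> w [/AH|->].
Qed.

Lemma maximal_johnson9_transversal (A : set 'rV[R]_9) :
  maximal_s_distance_set 3 H A -> J `<=` A ->
  transversal9 (A `&` Y) /\ A = extension9 (A `&` Y).
Proof.
move=> Amax JA; have [AH A3 _] := Amax.
have AJ := three_distance_sub_johnson9 AH A3 JA.
have [_ AA] := (@three_distance_setP R 9 A isT JA).1 A3.
(* The center is at squared distance 2 from all of J and of Y, so nothing prevents adjoining it. *)
have Ac : A c.
  apply: maximal_johnson9_mem => //; first by apply: johnson9_sub; left; right.
  move=> w /AJ[[Jw|->//]|Yw] wc; first exact: allowed_johnson_center.
  by rewrite sqdistC; apply: allowed_center_Y9 => //; exact: nesym.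
have one v : Y v -> A v -> ~ A (reflect_pt c v).
  move=> Yv Av Ar; apply: (not_allowed_reflect Yv); apply: AA => //.
  by apply: nesym; exact: Y9_reflect_neq.
(* The reflection of v is the only candidate point at a forbidden distance from v; if A lacks it, v
   can be adjoined. *)
have some v : Y v -> A v \/ A (reflect_pt c v).
  move=> Yv; have [Ar|nAr] := pselect (A (reflect_pt c v)); [by right|left].
  apply: maximal_johnson9_mem => //; first by apply: johnson9_sub; right.
  move=> w Aw wv; have [[Jw|cw]|Yw] := AJ _ Aw.
  - exact: allowed_johnson_Y9.
  - exact: allowed_center_Y9.
  - by apply: allowed_Y9 => // wr; apply: nAr; rewrite -wr.
split; last first.
  apply/seteqP; split=> [v Av|v [[/JA//|->//]|[]//]].
  by have [|] := AJ _ Av; [left|right].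
split=> [v []//|_ [v Yv <-]].
have [Av|Ar] := some v Yv.
  exists v; split; first by split; [left|].
  by move=> w [[->//|->] [Ar _]]; case: (one v).
exists (reflect_pt c v); split; first by split; [right|split=> //; exact: Y9_reflect].
by move=> w [[->|->//] [Av _]]; case: (one v).
Qed.

(** The reflection is an involution, so either member determines the pair; this makes the pairs
    disjoint. *)
Lemma reflection_pair_eq v w : [set v; reflect_pt c v] w ->
  [set v; reflect_pt c v] = [set w; reflect_pt c w].
Proof. by case=> ->; rewrite // reflect_ptK setUC. Qed.

Lemma reflection_pairs_partition :
  classical_sets.partition (reflection_pairs c Y) id Y.
Proof.
split.
- apply/seteqP; split=> [w [_ [v Yv <-] [->|->]]//|v Yv]; first exact: Y9_reflect.
  by exists [set v; reflect_pt c v]; [exists v|left].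
- move=> _ _ [v _ <-] [w _ <-] [u [/reflection_pair_eq -> /reflection_pair_eq ->]] //.
- by move=> _ [v _ <-]; exists v; left.
Qed.

Lemma card_reflection_pair p : reflection_pairs c Y p -> (p #= `I_2)%card.
Proof.
move=> [v Yv <-]; apply: (@card_eq_setU _ 1 1); [exact: card_set1|exact: card_set1|].
by apply/seteqP; split=> // w [-> /esym]; exact: Y9_reflect_neq.
Qed.

(** On Y this sends x0 + e_i - e_j to {i, j}, forgetting the sign of the root, so that reflection
    pairs correspond to 2-subsets. *)
Definition support9 v : {set 'I_9} := [set k | v 0 k != 1 / 3]%SET.

Lemma support9_bump9 i j : i != j -> support9 (y i j) = [set i; j]%SET.
Proof.
move=> ij; apply/setP => k; rewrite !inE mxE.
have [->|ki] := eqVneq k i; first by rewrite (negbTE ij) /=; apply/eqP; lra.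
by case: (k == j) => /=; apply/eqP; lra.
Qed.

(** Vectors of Y with the same support are equal or opposite, so the support maps Y' bijectively
    onto the 36 2-subsets. *)
Lemma card_transversal9 (Y' : set 'rV[R]_9) :
  transversal9 Y' -> (Y' #= `I_'C(9, 2))%card.
Proof.
move=> tY; have Y'Y := tY.1.
have inj : {in Y' &, injective support9}.
  move=> v w; rewrite !inE => Y'v Y'w; have nr := transversal9_unique tY Y'v.
  have Yv := Y'Y _ Y'v; have Yw := Y'Y _ Y'w.
  move: Yv Yw nr Y'w => /Y9P[i [j [ij ->]]] /Y9P[k [l [kl ->]]].
  rewrite !support9_bump9 // reflect_bump9 => nr Y'w ijkl.
  have : i \in [set k; l]%SET by rewrite -ijkl !inE eqxx.
  have : j \in [set k; l]%SET by rewrite -ijkl !inE eqxx orbT.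
  rewrite !inE; case/orP => /eqP jE; case/orP => /eqP iE.
  - by move: ij; rewrite iE jE eqxx.
  - by case: nr; rewrite iE jE.
  - by rewrite iE jE.
  - by move: ij; rewrite iE jE eqxx.
apply: card_eq_trans (card_esym (inj_card_eq inj)) _.
have -> : [set support9 v | v in Y'] =
    [set id S | S in [set` [set S : {set 'I_9} | #|S| == 2%N]%SET]].
  apply/seteqP; split=> [_ [v /Y'Y/Y9P[i [j [ij ->]]] <-]|_ [S + <-]].
    by exists (support9 (y i j)) => //=; rewrite inE support9_bump9 // cards2 ij.
  rewrite /= inE => /cards2P[i [j [ij ->]]].
  have [|Y'y|] := transversal9_exists tY (v := y i j).
  - by apply/Y9P; exists i, j.
  - by exists (y i j); rewrite // support9_bump9.
  - rewrite reflect_bump9 => Y'y; exists (y j i) => //.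
    by rewrite support9_bump9 1?eq_sym // finset.setUC.
rewrite -[X in 'C(X, _)]card_ord -card_draws.
by apply: card_image_finset.
Qed.

(** 121 = 84 + 1 + 36. *)
Lemma card_extension9 (Y' : set 'rV[R]_9) :
  transversal9 Y' -> (extension9 Y' #= `I_121)%card.
Proof.
move=> tY; have Y'Y := tY.1.
apply: (@card_eq_setU _ ('C(9, 3) + 1) 'C(9, 2)); last 1 first.
- apply/seteqP; split=> // v [Jcv /Y'Y/Y9P[i [j [ij]]]].
  case: Jcv => [/johnson3E[//|S S3 ->]|->].
    (* Away from i and j the entries of [y i j] are 1/3, whereas those of a Johnson vector are 0 or
       1. *)
    have [k] := @exists_notin 9 [:: i; j] isT.
    rewrite !inE negb_or => /andP[/negbTE ki /negbTE kj] /rowP /(_ k).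
    by rewrite !mxE ki kj; case: (k \in S) => /=; lra.
  by move=> /esym; exact: bump9_neq_center.
- apply: card_eq_setU; [exact: card_johnson|exact: card_set1|].
  apply/seteqP; split=> // _ [/johnson3E[//|S S3 ->] /rowP /(_ ord0)].
  by rewrite !mxE; case: (_ \in S); lra.
exact: card_transversal9.
Qed.

End Nine.

Theorem mainTheorem3 (R : realType) :
  [/\ (forall n : nat, (6 <= n)%N -> n <> 8%N -> n <> 9%N ->
         maximal_s_distance_set 3 (hyperplane R n 3) (johnson R n 3)),
      (let E := johnson R 8 3 `|` permvecs 8 [:: (1 / 2, 7%N); (- (1 / 2), 1%N)] in
       (forall A : set 'rV[R]_8,
          (maximal_s_distance_set 3 (hyperplane R 8 3) A /\ johnson R 8 3 `<=` A)
          <-> A = E)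
       /\ (E #= `I_64)%card)
    & [/\ classical_sets.partition (reflection_pairs (center9 R) (Y9 R)) id (Y9 R),
          (forall p, reflection_pairs (center9 R) (Y9 R) p -> (p #= `I_2)%card),
          (forall A : set 'rV[R]_9,
             (maximal_s_distance_set 3 (hyperplane R 9 3) A /\ johnson R 9 3 `<=` A)
             <-> exists2 Y', transversal9 Y' & A = extension9 Y')
        & forall Y' : set 'rV[R]_9,
            transversal9 Y' -> (extension9 Y' #= `I_121)%card]].
Proof.
split; first exact: johnson_maximal.
  by split; [exact: maximal_johnson8P|exact: card_johnson8].
split; [exact: reflection_pairs_partition|exact: card_reflection_pair| |exact: card_extension9].
move=> A; split=> [[Amax JA]|[Y' tY ->]].
  by have [] := maximal_johnson9_transversal Amax JA; exists (A `&` Y9 R).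
by split; [exact: maximal_extension9|move=> v; left; left].
Qed.
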